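(* Say a word $\sigma=\sigma_1\cdots\sigma_n$ over $\{1,\dots,k\}$ avoids $213$ if there is no index $i$ with $\sigma_{i+1}<\sigma_i<\sigma_{i+2}$, and let $F_{213}(x;k)=\sum_{n\ge0}f_{213}(n,k)x^n$, where $f_{213}(n,k)$ is the number of such words of length $n$. Then for all $k\ge1$, \[ F_{213}(x;k)=\frac{1}{1-x-x\sum_{i=0}^{k-2}\prod_{j=0}^{i}(1-jx^2)}, \] and $F_{213}(x;0)=1$.
   Context: The empty word (length $0$) is counted once; for $k=0$ there are no words of positive length; empty sums are $0$. *)

(* Defs.v *)
From HB Require Import structures.
From mathcomp Require Import all_boot all_order all_algebra.
From mathcomp Require Import boolp.

Set Implicit Arguments.
Unset Strict Implicit.
Unset Printing Implicit Defensive.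

Import Order.TTheory GRing.Theory Num.Theory.
Local Open Scope ring_scope.

(* The ring R[[x]] of formal power series over a commutative ring R, with     *)
(* the Cauchy product.  A series is a unit iff its constant coefficient is,   *)
(* so _^-1 and _ / _ have their usual meaning for such denominators.          *)

Record fps (R : Type) := Fps { fcoef : nat -> R }.

HB.instance Definition _ (R : Type) := gen_eqMixin (fps R).
HB.instance Definition _ (R : Type) := gen_choiceMixin (fps R).

Lemma fpsP (R : Type) (f g : fps R) : (forall n, fcoef f n = fcoef g n) -> f = g.
Proof. by case: f g => [f] [g] /= /funext ->. Qed.

Section FpsRing.
Variable R : comNzRingType.
Implicit Types f g h : fps R.

Definition fps_zero : fps R := Fps (fun=> 0).
Definition fps_one : fps R := Fps (fun n => (n == 0%N)%:R).
Definition fps_opp f := Fps (fun n => - fcoef f n).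
Definition fps_add f g := Fps (fun n => fcoef f n + fcoef g n).
Definition fps_mul f g :=
  Fps (fun n => \sum_(i < n.+1) fcoef f i * fcoef g (n - i)).
Definition fpsX : fps R := Fps (fun n => (n == 1%N)%:R).

Lemma fps_addA : associative fps_add.
Proof. by move=> f g h; apply: fpsP => n /=; rewrite addrA. Qed.
Lemma fps_addC : commutative fps_add.
Proof. by move=> f g; apply: fpsP => n /=; rewrite addrC. Qed.
Lemma fps_add0 : left_id fps_zero fps_add.
Proof. by move=> f; apply: fpsP => n /=; rewrite add0r. Qed.
Lemma fps_addN : left_inverse fps_zero fps_opp fps_add.
Proof. by move=> f; apply: fpsP => n /=; rewrite addNr. Qed.

HB.instance Definition _ :=
  GRing.isZmodule.Build (fps R) fps_addA fps_addC fps_add0 fps_addN.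

Definition fps_trunc f n : {poly R} := \poly_(i < n.+1) fcoef f i.

Lemma coef_fps_trunc f n i :
  (i <= n)%N -> (fps_trunc f n)`_i = fcoef f i.
Proof. by move=> le_in; rewrite coef_poly ltnS le_in. Qed.

Lemma fps_mul_trunc f g n m : (m <= n)%N ->
  fcoef (fps_mul f g) m = (fps_trunc f n * fps_trunc g n)`_m.
Proof.
move=> le_mn; rewrite coefM /=; apply: eq_bigr => i _.
rewrite !coef_fps_trunc //; first exact: leq_trans (leq_subr _ _) le_mn.
by rewrite (leq_trans _ le_mn) // -ltnS.
Qed.

Lemma fps_mulC : commutative fps_mul.
Proof.
by move=> f g; apply: fpsP => n; rewrite !(fps_mul_trunc _ _ (leqnn n)) mulrC.
Qed.

Lemma fps_mulA : associative fps_mul.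
Proof.
move=> f g h; apply: fpsP => n.
transitivity ((fps_trunc f n * (fps_trunc g n * fps_trunc h n))`_n).
  rewrite coefM [LHS]/=; apply: eq_bigr => i _.
  have le_in : (i <= n)%N by rewrite -ltnS.
  by rewrite -(fps_mul_trunc _ _ (leq_subr i n)) coef_fps_trunc.
rewrite mulrA coefM [RHS]/=; apply: eq_bigr => i _.
have le_in : (i <= n)%N by rewrite -ltnS.
by rewrite -(fps_mul_trunc _ _ le_in) coef_fps_trunc ?leq_subr.
Qed.

Lemma fps_mul1 : left_id fps_one fps_mul.
Proof.
move=> f; apply: fpsP => n /=; rewrite big_ord_recl /= mul1r subn0.
by rewrite big1 ?addr0 // => i _; rewrite mul0r.
Qed.

Lemma fps_mulDl : left_distributive fps_mul fps_add.
Proof.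
move=> f g h; apply: fpsP => n /=; rewrite -big_split /=.
by apply: eq_bigr => i _; rewrite mulrDl.
Qed.

Lemma fps_one_neq0 : fps_one != 0.
Proof.
by apply/eqP => /(congr1 (fun f => fcoef f 0)) /= /eqP; rewrite oner_eq0.
Qed.

HB.instance Definition _ :=
  GRing.Zmodule_isComNzRing.Build (fps R)
    fps_mulA fps_mulC fps_mul1 fps_mulDl fps_one_neq0.

Lemma fcoef0 n : fcoef (0 : fps R) n = 0. Proof. by []. Qed.
Lemma fcoef1 n : fcoef (1 : fps R) n = (n == 0%N)%:R. Proof. by []. Qed.
Lemma fcoefX n : fcoef fpsX n = (n == 1%N)%:R. Proof. by []. Qed.
Lemma fcoefN f n : fcoef (- f) n = - fcoef f n. Proof. by []. Qed.
Lemma fcoefD f g n : fcoef (f + g) n = fcoef f n + fcoef g n.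
Proof. by []. Qed.
Lemma fcoefM f g n :
  fcoef (f * g) n = \sum_(i < n.+1) fcoef f i * fcoef g (n - i).
Proof. by []. Qed.

Lemma fcoef_sum (I : Type) (r : seq I) (P : pred I) (F : I -> fps R) n :
  fcoef (\sum_(i <- r | P i) F i) n = \sum_(i <- r | P i) fcoef (F i) n.
Proof. by elim/big_rec2: _ => // i x y _ <-. Qed.

Lemma fcoefX_lt0 f m n :
  fcoef f 0 = 0 -> (m < n)%N -> fcoef (f ^+ n) m = 0.
Proof.
move=> f0; elim: n m => // n IHn m lt_mn; rewrite exprS fcoefM.
apply: big1 => -[[|i] /= lt_im] _; first by rewrite f0 mul0r.
by rewrite IHn ?mulr0 //; move: lt_im lt_mn; case: m => // m; rewrite !ltnS;
  move=> _; apply: leq_ltn_trans; rewrite subSS leq_subr.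
Qed.

End FpsRing.

Section FpsUnitRing.
Variable R : comUnitRingType.
Implicit Types f g : fps R.

Definition fps_const (c : R) : fps R := Fps (fun n => c *+ (n == 0%N)).

Lemma fcoef_constM c f n : fcoef (fps_const c * f) n = c * fcoef f n.
Proof.
rewrite fcoefM big_ord_recl subn0 big1 ?addr0 // => i _.
by rewrite /= mul0r.
Qed.

Definition fps_unit : pred (fps R) := fun f => fcoef f 0 \is a GRing.unit.

(* With f = f_0 (1 - w), the inverse is f_0^-1 \sum_i w^i, a sum that is      *)
(* finite in each degree because w has zero constant coefficient.             *)
Definition fps_inv f : fps R :=
  if fps_unit f then
    let u := fps_const (fcoef f 0)^-1 in
    u * Fps (fun n => fcoef (\sum_(i < n.+1) (1 - u * f) ^+ i) n)
  else f.

Lemma fps_mulV : {in fps_unit, left_inverse 1 fps_inv *%R}.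
Proof.
move=> f fU; rewrite /fps_inv; have fU' : fps_unit f by [].
rewrite fU' /=; set u := fps_const _; set w := 1 - u * f.
have w0 : fcoef w 0 = 0.
  by rewrite fcoefD fcoefN fcoef_constM mulVr // fcoef1 subrr.
rewrite mulrAC -[u * f](subKr 1) -/w; apply: fpsP => n.
transitivity (fcoef ((1 - w) * \sum_(i < n.+1) w ^+ i) n).
  rewrite !fcoefM; apply: eq_bigr => i _; congr (_ * _) => /=.
  rewrite !fcoef_sum -(big_mkord xpredT (fun j => fcoef (w ^+ j) (n - i))).
  rewrite -(big_mkord xpredT (fun j => fcoef (w ^+ j) (n - i))).
  rewrite [RHS](big_cat_nat (n := (n - i).+1)) //= ?ltnS ?leq_subr //.
  rewrite [X in _ + X]big_nat_cond [X in _ + X]big1 ?addr0 // => j.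
  by rewrite andbT => /andP[lt_j _]; apply: fcoefX_lt0.
rewrite -opprB mulNr -subrX1 opprB fcoefD fcoefN fcoefX_lt0 //.
by rewrite subr0.
Qed.

Lemma fps_unitPl f g : g * f = 1 -> fps_unit f.
Proof.
move=> /(congr1 (fun h => fcoef h 0)); rewrite fcoefM big_ord1 subn0 fcoef1.
by move=> gf1; apply/unitrPr; exists (fcoef g 0); rewrite mulrC.
Qed.

Lemma fps_inv_out : {in [predC fps_unit], fps_inv =1 id}.
Proof. by move=> f; rewrite !inE /fps_inv => nU; case: ifP => // fU; case/negP: nU. Qed.

HB.instance Definition _ :=
  GRing.ComNzRing_hasMulInverse.Build (fps R) fps_mulV fps_unitPl fps_inv_out.

Lemma fps_unitE f : (f \is a GRing.unit) = (fcoef f 0 \is a GRing.unit).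
Proof. by []. Qed.

End FpsUnitRing.

Arguments fpsX {R}.

(* Positions are 0-based. *)
Definition avoids213 (s : seq nat) : bool :=
  ~~ [exists i : 'I_(size s),
       [&& (i.+2 < size s)%N, (nth 0 s i.+1 < nth 0 s i)%N
         & (nth 0 s i < nth 0 s i.+2)%N]].

(* The element a of 'I_k stands for the letter a + 1 of {1, ..., k}. *)
Definition f213 (n k : nat) : nat :=
  #|[set w : n.-tuple 'I_k | avoids213 [seq (val a).+1 | a <- w]]|.

Definition F213 (k : nat) : fps int := Fps (fun n => (f213 n k)%:R).

(* Main.v *)
Require Import Defs.
From mathcomp Require Import all_boot all_order all_algebra.
Import GRing.Theory.
Local Open Scope ring_scope.

(** Let [Q c] enumerate the nonempty avoiding words by length, where [c] is the
last letter, counted from 0.  The occurrences of 213 in a word ending in [c.+1]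
that disappear when this letter is lowered to [c] are those ending in
[c a c.+1] with [a < c]; removing the last two letters leaves an arbitrary
avoiding word ending in [c], because a final descent creates no occurrence.
Hence [Q c.+1 = (1 - c x^2) Q c], while [Q 0 = x F] since a smallest letter can
be appended to any avoiding word.  Thus [F = 1 + \sum_(c < k) Q c] is a linear
equation for [F]. *)

(* Avoidance for words read from right to left, so that appending a letter
   becomes [cons]. *)
Fixpoint rev_avoids (s : seq nat) : bool :=
  if s is c :: t then
    (if t is a :: b :: _ then ~~ (a < b < c)%N else true) && rev_avoids t
  else true.

Lemma rev_avoidsP (s : seq nat) :
  reflect (forall i, (i.+2 < size s)%N ->
             ~~ (nth 0%N s i.+1 < nth 0%N s i.+2 < nth 0%N s i)%N)
          (rev_avoids s).
Proof.
elim: s => [|c t IHt]; first by apply: ReflectT.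
apply: (iffP andP) => [[ct /IHt t_av] [|i] //= | ct_av].
- by case: t ct {IHt t_av} => [|a [|b t]].
- exact: t_av.
split; last by apply/IHt => i; apply: (ct_av i.+1).
by case: t ct_av {IHt} => [|a [|b t]] // /(_ 0%N isT).
Qed.

Lemma avoids213_rev (s : seq nat) : avoids213 s = rev_avoids (rev s).
Proof.
apply/idP/rev_avoidsP => [s_av i | s_av].
  rewrite size_rev => lt_i; apply/negP => /andP[lt1 lt2].
  (* Index [i] of [rev s] holds the last letter of the occurrence, whose first letter has index
     [size s - i.+3] in [s]. *)
  have lt_j : (size s - i.+3 < size s)%N by rewrite ltn_subrL /= (leq_trans _ lt_i).
  case/existsP: s_av; exists (Ordinal lt_j) => /=.
  move: lt1 lt2; rewrite !nth_rev ?(ltnW lt_i) ?(ltnW (ltnW lt_i)) //.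
  rewrite -(subSn lt_i) subSS -(subSn (ltnW lt_i)) subSS => -> ->.
  by rewrite ltn_subrL /= (leq_trans _ lt_i).
apply/existsP => -[[i /= _] /and3P[lt_i lt1 lt2]].
have := s_av (size s - i.+3)%N.
rewrite size_rev -(subSn lt_i) subSS -(subSn (ltnW lt_i)) subSS.
have rev_sub j : (j < size s)%N -> nth 0%N (rev s) (size s - j.+1) = nth 0%N s j.
  by move=> lt_j; rewrite nth_rev subnSK ?subKn ?leq_subr // ltnW.
rewrite ltn_subrL /= (leq_trans _ lt_i) // => /(_ isT).
by rewrite !rev_sub ?lt1 ?lt2 // ltnW // ltnW.
Qed.

Lemma rev_avoids_succ (s : seq nat) : rev_avoids [seq a.+1 | a <- s] = rev_avoids s.
Proof. by elim: s => //= c [|a [|b t]] //= ->. Qed.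

Lemma rev_avoids_cons0 (s : seq nat) : rev_avoids (0%N :: s) = rev_avoids s.
Proof. by case: s => [|a [|b t]] //=; rewrite andbF. Qed.

(** The conditions [a < b < c] and [a < b < c.+1] differ only when [a < b] and [b = c]; the
    correction term records this case. *)
Lemma rev_avoids_consS (c a b : nat) (s : seq nat) :
  (rev_avoids [:: c, a, b & s] =
   rev_avoids [:: c.+1, a, b & s]
     + (b == c) * ((a < b) * rev_avoids (b :: s)) :> nat)%N.
Proof.
(* An occurrence ending in [a] would need a letter [d] with [b < d < a], contrary to [a < b]. *)
have descent : (a < b)%N -> rev_avoids [:: a, b & s] = rev_avoids (b :: s).
  move=> lt_ab /=; case: s => [|d s] //=.
  by case: ltnP => //= lt_bd; rewrite ltnNge ltnW // (ltn_trans lt_ab).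
rewrite -[rev_avoids (c :: _)]/(~~ (a < b < c)%N && rev_avoids [:: a, b & s]).
rewrite -[rev_avoids (c.+1 :: _)]/(~~ (a < b < c.+1)%N && rev_avoids [:: a, b & s]).
case: (ltnP a b) => [/descent -> | _]; last by rewrite mul0n muln0 addn0.
by case: (rev_avoids (b :: s)); rewrite [(b < c.+1)%N]leq_eqVlt eqSS ltnS; case: ltngtP.
Qed.

Lemma big_tuple_cons {R : Type} {idx : R} {op : Monoid.com_law idx}
    {T : finType} {n : nat} (F : n.+1.-tuple T -> R) :
  \big[op/idx]_(w : n.+1.-tuple T) F w =
  \big[op/idx]_(c : T) \big[op/idx]_(w : n.-tuple T) F [tuple of c :: w].
Proof.
rewrite pair_bigA /= (reindex (fun p : T * n.-tuple T => [tuple of p.1 :: p.2])) //.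
exists (fun w => (thead w, [tuple of behead w])) => [[c w] _ | w _].
  by congr (_, _); apply/val_inj.
by rewrite [RHS]tuple_eta.
Qed.

Lemma fcoefXM0 {R : comNzRingType} (g : fps R) : fcoef (fpsX * g) 0 = 0.
Proof. by rewrite fcoefM big_ord1 mul0r. Qed.

Lemma fcoefXMS {R : comNzRingType} (g : fps R) (n : nat) :
  fcoef (fpsX * g) n.+1 = fcoef g n.
Proof.
rewrite fcoefM !big_ord_recl big1 => [|i _]; last by rewrite fcoefX mul0r.
by rewrite !fcoefX /= mul0r add0r mul1r addr0 subSS subn0.
Qed.

Lemma fcoef_natM {R : comNzRingType} (m : nat) (g : fps R) (n : nat) :
  fcoef (m%:R * g) n = m%:R * fcoef g n.
Proof.
elim: m => [|m IHm]; first by rewrite !mul0r.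
by rewrite !mulrS !mulrDl fcoefD IHm !mul1r.
Qed.

Section Count.
Variable k : nat.

Definition letters {n : nat} (w : n.-tuple 'I_k) : seq nat := [seq val a | a <- w].

Lemma f213E (n : nat) :
  f213 n k = (\sum_(w : n.-tuple 'I_k) rev_avoids (letters w))%N.
Proof.
rewrite /f213 -sum1_card big_mkcond /=.
have rev_tupleK : involutive (fun w : n.-tuple 'I_k => [tuple of rev w]).
  by move=> w; apply/val_inj; rewrite /= revK.
rewrite (reindex_inj (inv_inj rev_tupleK)) /=; apply: eq_bigr => w _.
rewrite inE avoids213_rev -map_rev /= revK.
by rewrite (map_comp succn) rev_avoids_succ; case: rev_avoids.
Qed.

(** [n] counts the letters before the last one. The last letter [c] is a natural number rather than
    an element of ['I_k], so that the recurrence from [c] to [c.+1] also covers [c.+1 = k]. *)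
Definition avoiders_ending (n c : nat) : nat :=
  (\sum_(w : n.-tuple 'I_k) rev_avoids (c :: letters w))%N.

Lemma f213S (n : nat) : f213 n.+1 k = (\sum_(c < k) avoiders_ending n c)%N.
Proof. by rewrite f213E big_tuple_cons. Qed.

Lemma avoiders_ending0 (n : nat) : avoiders_ending n 0 = f213 n k.
Proof. by rewrite f213E; apply: eq_bigr => w _; rewrite rev_avoids_cons0. Qed.

(** An occurrence takes three letters, so these words all avoid 213. *)
Lemma avoiders_ending_lt2 (n c d : nat) :
  (n < 2)%N -> avoiders_ending n c = avoiders_ending n d.
Proof.
move=> lt_n2; apply: eq_bigr => w _.
have : (size (letters w) < 2)%N by rewrite size_map size_tuple.
by case: (letters w) => [|a [|]].
Qed.

(** The number of letters that complete a descent from [b]; it becomes the coefficient [j] in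
    [1 - j x^2]. *)
Lemma sum_ltn_ord (b : nat) : (b <= k)%N -> (\sum_(a < k) (a < b) = b)%N.
Proof.
move=> le_bk; rewrite -(big_mkord xpredT (fun a => (a < b)%N : nat)).
rewrite (big_cat_nat (n := b)) //= [X in (_ + X)%N]big_nat_cond.
rewrite [X in (_ + X)%N]big1 => [|a /andP[/andP[le_ba _] _]]; last first.
  by rewrite ltnNge le_ba.
rewrite addn0 (eq_big_nat _ _ (F2 := fun=> 1%N)) => [|a /andP[_ ->]] //.
by rewrite sum_nat_const_nat muln1 subn0.
Qed.

Lemma avoiders_endingSS (n c : nat) : (c < k)%N ->
  (avoiders_ending n.+2 c = avoiders_ending n.+2 c.+1 + c * avoiders_ending n c)%N.
Proof.
move=> lt_ck; rewrite /avoiders_ending !big_tuple_cons /=.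
have -> : (c * \sum_(w : n.-tuple 'I_k) rev_avoids (c :: letters w) =
    \sum_(a < k) (a < c) * \sum_(w : n.-tuple 'I_k) rev_avoids (c :: letters w))%N.
  by rewrite -big_distrl sum_ltn_ord // ltnW.
rewrite -big_split /=; apply: eq_bigr => a _; rewrite !big_tuple_cons.
(* The term [b = c] is split off on both sides, as only it carries a correction. *)
rewrite [LHS](bigD1 (Ordinal lt_ck)) //=.
rewrite [X in _ = (X + _)%N](bigD1 (Ordinal lt_ck)) //= -addnA [X in _ = (_ + X)%N]addnC addnA.
congr (_ + _)%N.
  rewrite big_distrr -big_split /=; apply: eq_bigr => w _.
  by rewrite [LHS]rev_avoids_consS eqxx mul1n.
apply: eq_bigr => b /negbTE ne_bc; apply: eq_bigr => w _.
have {}ne_bc : (val b == c) = false by [].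
by rewrite [LHS]rev_avoids_consS ne_bc mul0n addn0.
Qed.

Definition ending_gf (c : nat) : fps int :=
  Fps (fun n => if n is m.+1 then (avoiders_ending m c)%:R else 0).

Lemma ending_gf0 : ending_gf 0 = fpsX * F213 k.
Proof.
apply: fpsP => -[|n]; first by rewrite fcoefXM0.
by rewrite fcoefXMS /= avoiders_ending0.
Qed.

Lemma ending_gfS (c : nat) : (c < k)%N ->
  ending_gf c.+1 = ending_gf c * (1 - c%:R * fpsX ^+ 2).
Proof.
move=> lt_ck; rewrite mulrBr mulr1 mulrC -mulrA expr2 -mulrA.
apply: fpsP => n; rewrite fcoefD fcoefN fcoef_natM.
(* In degrees 1 and 2 the [x^2] term contributes nothing and the words are too short for an
   occurrence; from degree 3 on this is [avoiders_endingSS]. *)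
case: n => [|[|n]]; rewrite ?fcoefXMS ?fcoefXM0 ?mulr0 ?subr0 //=.
  by rewrite (avoiders_ending_lt2 _ c.+1 c).
case: n => [|n] /=; first by rewrite mulr0 subr0 (avoiders_ending_lt2 _ c.+1 c).
by rewrite (avoiders_endingSS _ _ lt_ck) natrD natrM addrK.
Qed.

Lemma ending_gfE (c : nat) : (c <= k)%N ->
  ending_gf c = fpsX * F213 k * \prod_(0 <= j < c) (1 - j%:R * fpsX ^+ 2).
Proof.
elim: c => [_|c IHc lt_ck]; first by rewrite big_geq // mulr1 ending_gf0.
by rewrite ending_gfS // (IHc (ltnW lt_ck)) big_nat_recr //= [RHS]mulrA.
Qed.

Lemma F213_ending : F213 k = 1 + \sum_(0 <= c < k) ending_gf c.
Proof.
apply: fpsP => n; rewrite fcoefD fcoef_sum; case: n => [|n] /=.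
  (* The constant coefficient counts the empty word. *)
  rewrite big1 // f213E addr0; congr (_%:R).
  rewrite (eq_bigr (fun=> 1%N)) => [|w _]; last by rewrite tuple0.
  by rewrite sum1_card card_tuple expn0.
by rewrite add0r f213S natr_sum big_mkord.
Qed.

Lemma F213_eq :
  F213 k =
    1 + fpsX * F213 k * \sum_(0 <= c < k) \prod_(0 <= j < c) (1 - j%:R * fpsX ^+ 2).
Proof.
rewrite {1}F213_ending mulr_sumr; congr (_ + _).
by apply: eq_big_nat => c /andP[_ lt_ck]; rewrite ending_gfE // ltnW.
Qed.

End Count.

Theorem theorem3p16 :
  (forall k : nat, (1 <= k)%N ->
     F213 k =
       1 / (1 - fpsX - fpsX * \sum_(0 <= i < k.-1)
                                \prod_(0 <= j < i.+1) (1 - j%:R * fpsX ^+ 2)))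
  /\ F213 0 = 1.
Proof.
split; last by rewrite F213_eq big_geq // mulr0 addr0.
case=> // k _; have := F213_eq k.+1.
(* The summand [c = 0] is an empty product, equal to 1; it yields the separate [- fpsX] in the
   denominator. *)
rewrite big_nat_recl //= big_geq //; set S := \sum_(0 <= i < k) _ => eqF.
set D := 1 - fpsX - _; have FD : F213 k.+1 * D = 1.
  have -> : D = 1 - fpsX * (1 + S) by rewrite mulrDr mulr1 opprD addrA.
  by rewrite mulrBr mulr1 mulrA [F213 _ * fpsX]mulrC {1}eqF addrK.
(* The equation [FD] itself exhibits the inverse of [D]. *)
have unitD : D \is a GRing.unit by apply/unitrPr; exists (F213 k.+1); rewrite mulrC.
by apply: (canRL (mulrK unitD)).
Qed.
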